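(* Let $P=[\widehat{0},\widehat{1}]$ be a graded dual simplicial Eulerian poset of rank $n+1$, and let $(h_0,\ldots,h_n)$ be the toric $h$-vector of $(P\setminus\{\widehat{0}\})^*$. Then \begin{align*} \operatorname{t}([\widehat{0},\widehat{1}),x)&=h_0 \left(t_n(x)-(n-1)t_{n-2}(x)\right)\\ &\quad+\sum_{i=1}^{n-1} h_i \sum_{k=1}^{\left\lfloor n/2\right\rfloor} \left(\binom{n-i}{k}\binom{i-1}{k-1}-\binom{n-i-1}{k}\binom{i}{k-1}\right) t_{n-2k}(x). \end{align*}
   Context: A graded poset is a finite poset with a unique minimum $\widehat{0}$, a unique maximum $\widehat{1}$ and a rank function $\rho:P\to\mathbb{N}$ with $\rho(\widehat{0})=0$ and $\rho(y)=\rho(x)+1$ whenever $y$ covers $x$; its rank is $\rho(\widehat{1})$. It is Eulerian if $\sum_{z\in[u,v]}(-1)^{\rho(z)}=0$ for all $u<v$. It is dual simplicial if for every $t\neq\widehat{0}$ the interval $[t,\widehat{1}]$ is a Boolean algebra. $Q^*$ denotes the dual (order-reversed) poset of $Q$. Write $[\widehat{0},p)=\{q: q<p\}$. Stanley's toric polynomials: $f(\emptyset,x)=g(\emptyset,x)=1$ ($\emptyset$ being $[\widehat{0},\widehat{1})$ for the Eulerian poset of rank $0$), and for an Eulerian poset of rank at least $1$, $$f([\widehat{0},\widehat{1}),x)=\sum_{p\in[\widehat{0},\widehat{1})} g([\widehat{0},p),x)(x-1)^{\rho(\widehat{1})-1-\rho(p)},$$ $$g([\widehat{0},\widehat{1}),x)=\sum_{i=0}^{\lfloor(\rho(\widehat{1})-1)/2\rfloor}\left([x^i]f([\widehat{0},\widehat{1}),x)-[x^{i-1}]f([\widehat{0},\widehat{1}),x)\right)x^i.$$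 By a theorem of Stanley, if the rank is $n+1$ then $f([\widehat{0},\widehat{1}),x)$ has degree $n$ and satisfies $x^nf([\widehat{0},\widehat{1}),1/x)=f([\widehat{0},\widehat{1}),x)$. Toric $h$-vector: for an Eulerian poset $Q$ of rank $n+1$, the toric $h$-vector $(h_0,\dots,h_n)$ of $Q\setminus\{\widehat{1}_Q\}$ is defined by $\sum_i h_ix^i=x^nf(Q\setminus\{\widehat{1}_Q\},1/x)$ (which equals $f(Q\setminus\{\widehat{1}_Q\},x)$). Here it is applied to $Q=P^*$, whose maximum is $\widehat{0}$, so $Q\setminus\{\widehat 1_Q\}=(P\setminus\{\widehat{0}\})^*$; explicitly $h_k=\sum_{i=k}^n(-1)^{i-k}\binom{i}{k}f_i(P)$, where $f_i(P)$ is the number of elements of rank $i+1$ in $P$. Short toric polynomial: for an Eulerian poset of rank $n+1$, $\operatorname{t}([\widehat{0},\widehat{1}),x)$ is the unique polynomial $q(x)$ of degree $n$ with $q(x)=(-1)^nq(-x)$ and $f([\widehat{0},\widehat{1}),x)=x^{n/2}\left(q(\sqrt{x})+q(1/\sqrt{x})-q(0)\right)$; equivalently, it is obtained from $x^{n}f([\widehat{0},\widehat{1}),x^{-2})$ by discarding all terms of negative degree. $t_m(x)$ denotes the short toric polynomial of the Boolean algebra of rank $m+1$ (with its maximum removed); explicitly $t_m(x)=\sum_{k=0}^{\lfloor m/2\rfloor}x^{m-2k}$ for $m\geq0$. Convention: $t_m(x)=0$ for $m<0$. *)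

(* Defs.v *)
From HB Require Import structures.
From mathcomp Require Import all_boot all_order all_algebra.

Set Implicit Arguments.
Unset Strict Implicit.
Unset Printing Implicit Defensive.

Import Order.TTheory Order.DefaultSetSubsetOrder GRing.Theory Num.Theory.
Local Open Scope ring_scope.

Section Posets.
Variables (d : Order.disp_t) (P : finTBPOrderType d).
Implicit Types (x y z u v p : P) (rho : P -> nat).

Definition covers y x := (x < y)%O && [forall z, ~~ ((x < z)%O && (z < y)%O)].

Definition graded rho :=
  rho \bot%O = 0%N /\ forall x y, covers y x -> rho y = (rho x).+1.

Definition eulerian rho :=
  forall u v, (u < v)%O -> \sum_(z | (u <= z <= v)%O) (-1) ^+ rho z = 0 :> int.

(* [u, v] is order-isomorphic to the lattice of subsets of a k-element set. *)
Definition boolean_interval u v :=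
  exists (k : nat) (phi : P -> {set 'I_k}),
    {in [pred z | (u <= z <= v)%O] &,
      forall x y, (x <= y)%O = (phi x \subset phi y)} /\
    (forall A : {set 'I_k}, exists2 x, (u <= x <= v)%O & phi x = A).

Definition dual_simplicial := forall t, t != \bot%O -> boolean_interval t \top%O.

Definition dual_rank rho : P^d -> nat := fun x => (rho \top%O - rho x)%N.

(* g of a poset of rank r, computed from its polynomial f. *)
Definition toric_trunc (r : nat) (f : {poly int}) : {poly int} :=
  \poly_(i < (r.-1)./2.+1) (f`_i - (if i is j.+1 then f`_j else 0)).

(* The fuel k bounds the number of elements below v; see toric_fE for the
   recurrence, in which the fuel has disappeared. *)
Fixpoint toric_f_rec rho (k : nat) v : {poly int} :=
  if k is k'.+1 then
    if v == \bot%O then 1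
    else \sum_(p | (p < v)%O)
           (if p == \bot%O then 1 else toric_trunc (rho p) (toric_f_rec rho k' p))
           * ('X - 1) ^+ (rho v - 1 - rho p)
  else 1.

(* toric_f rho v and toric_g rho v are f([0, v), x) and g([0, v), x). *)
Definition toric_f rho v := toric_f_rec rho #|[pred p | (p < v)%O]| v.

Definition toric_g rho v : {poly int} :=
  if v == \bot%O then 1 else toric_trunc (rho v) (toric_f rho v).

(* The i-th entry (0 <= i <= n) of the toric h-vector of P minus its maximum,
   where P has rank n + 1: the coefficient of x^i in x^n f(P \ {1}, 1/x). *)
Definition toric_h rho (i : nat) : int :=
  (toric_f rho \top%O)`_((rho \top%O).-1 - i).

End Posets.

(* x^n f(x^-2) without its terms of negative degree. By short_truncP below, for
   palindromic f of degree n this is the unique q of degree n such that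
   q(x) = (-1)^n q(-x) and f(x) = x^(n/2) (q(sqrt x) + q(1/sqrt x) - q(0)). *)
Definition short_trunc (n : nat) (f : {poly int}) : {poly int} :=
  \sum_(j < size f | (2 * j <= n)%N) f`_j *: 'X^(n - 2 * j).

Definition short_toric d (P : finTBPOrderType d) (rho : P -> nat) : {poly int} :=
  short_trunc (rho \top%O).-1 (toric_f rho \top%O).

(* DefaultSetSubsetOrder orders {set 'I_r} by inclusion. *)
Definition boolean_rank (r : nat) (A : {set 'I_r}) : nat := #|A|.

(* The explicit formula is t_E. *)
Definition t_ (m : int) : {poly int} :=
  match m with
  | Posz k => @short_toric _ {set 'I_k.+1} (@boolean_rank k.+1)
  | Negz _ => 0
  end.

Section Facts.
Variables (d : Order.disp_t) (P : finTBPOrderType d).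
Implicit Types (x y z u v p : P) (rho : P -> nat).

Lemma card_below_lt p v : (p < v)%O ->
  (#|[pred q : P | (q < p)%O]| < #|[pred q : P | (q < v)%O]|)%N.
Proof.
move=> pv; apply/proper_card/properP; split.
  by apply/subsetP => q; rewrite !inE => qp; apply: lt_trans qp pv.
by exists p; rewrite !inE ?pv ?ltxx.
Qed.

Lemma toric_f_rec_fuel rho k v : (#|[pred p : P | (p < v)%O]| <= k)%N ->
  toric_f_rec rho k v = toric_f rho v.
Proof.
rewrite /toric_f; set m := #|_|; have := leqnn m; rewrite {1}/m.
move: m => m; elim: m k v => [|m IH] [|k] v //=.
- case: eqP => // /eqP v0 + _; rewrite leqn0 => /eqP/card0_eq/(_ \bot%O).
  by rewrite inE lt0x v0.
- move=> hm hk; case: eqP => // _; apply: eq_bigr => p pv; case: eqP => // _.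
  have hp := card_below_lt pv.
  congr (toric_trunc _ _ * _).
  have hpm : (#|[pred q : P | (q < p)%O]| <= m)%N by rewrite -ltnS (leq_trans hp).
  by apply: IH => //; rewrite -ltnS (leq_trans hp).
Qed.

Lemma toric_f0 rho : toric_f rho \bot%O = 1.
Proof. by rewrite /toric_f; case: #|_| => //= k; rewrite eqxx. Qed.

Lemma toric_fE rho v : v != \bot%O ->
  toric_f rho v =
    \sum_(p | (p < v)%O) toric_g rho p * ('X - 1) ^+ (rho v - 1 - rho p).
Proof.
move=> v0; rewrite -(@toric_f_rec_fuel rho #|[pred p | (p < v)%O]|.+1) //=.
rewrite (negPf v0); apply: eq_bigr => p pv; rewrite /toric_g.
by rewrite toric_f_rec_fuel // ltnW // card_below_lt.
Qed.

End Facts.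

Lemma graded_lt d (P : finTBPOrderType d) (rho : P -> nat) (x y : P) :
  graded rho -> (x < y)%O -> (rho x < rho y)%N.
Proof.
case=> _ rho_cov; have [k] := ubnP #|[pred z : P | (x < z < y)%O]|.
elim: k x y => // k IH x y lek xy.
case: (boolP [exists z, (x < z)%O && (z < y)%O]) => [/existsP[z /andP[xz zy]]|].
  have sub (a b : P) : (x <= a)%O -> (b <= y)%O ->
      ~~ (a < z < b)%O -> (x < z < y)%O -> (#|[pred w | (a < w < b)%O]| < k)%N.
    move=> xa bya nz xzy; rewrite -ltnS; apply: leq_ltn_trans lek.
    apply/proper_card/properP; split.
      apply/subsetP => w; rewrite !inE => /andP[aw wb].
      by rewrite (le_lt_trans xa aw) (lt_le_trans wb bya).
    by exists z; rewrite !inE.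
  apply: (@ltn_trans (rho z)); apply: IH => //; apply: sub => //;
    by rewrite ?xz ?zy ?ltxx ?andbF ?(ltW xz) ?(ltW zy).
move=> nz; rewrite (rho_cov x y) // /covers xy /=; apply/forallP => z.
by apply: contra nz => ?; apply/existsP; exists z.
Qed.

Lemma graded_dual d (P : finTBPOrderType d) (rho : P -> nat) :
  graded rho -> graded (dual_rank rho).
Proof.
move=> grd; have [_ rho_cov] := grd; split; first exact: subnn.
move=> x y /andP[xy /forallP nz].
have /rho_cov rx : covers (x : P) (y : P).
  apply/andP; split=> //; apply/forallP => z.
  by have := nz z; rewrite andbC.
have : (rho x <= rho \top%O)%N.
  case: (eqVneq (x : P) \top%O) => [->//|xn].
  by apply/ltnW/(graded_lt grd); rewrite lt_def lex1 eq_sym xn.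
by rewrite /dual_rank rx => /subnSK <-.
Qed.

Lemma graded_boolean (r : nat) : graded (@boolean_rank r).
Proof.
have subE (A B : {set 'I_r}) : (A <= B)%O = (A \subset B) by [].
split=> [|A B /andP[]]; first exact: cards0.
rewrite lt_neqAle subE -properEneq => /properP[sAB [i iB iA]] /forallP nC.
have := nC (i |: A); rewrite !lt_neqAle !subE subsetUr subUset sub1set iB sAB.
rewrite !andbT; have -> /= : A != i |: A.
  by apply: contraNneq iA => ->; rewrite setU11.
by rewrite negbK => /eqP <-; rewrite /boolean_rank cardsU1 iA.
Qed.

Lemma coef_short_trunc n (f : {poly int}) k :
  (short_trunc n f)`_k = if (k <= n)%N && ~~ odd (n - k) then f`_((n - k)./2) else 0.
Proof.
rewrite /short_trunc coef_sum.
under eq_bigr do rewrite coefZ coefXn.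
case: ifP => [/andP[kn ev]|h].
  have e2 : (2 * (n - k)./2 = n - k)%N by rewrite mul2n even_halfK.
  have [lt|ge] := ltnP (n - k)./2 (size f).
    rewrite (bigD1 (Ordinal lt)) /=; last by rewrite e2 leq_subr.
    rewrite e2 subKn // eqxx mulr1 big1 ?addr0 // => j /andP[jn /eqP nj].
    case: eqP => [kj|]; last by rewrite mulr0.
    by case: nj; apply: val_inj; rewrite /= kj subKn // mul2n doubleK.
  rewrite nth_default // big1 // => j jn; case: eqP => [kj|]; last by rewrite mulr0.
  by have := ltn_ord j; rewrite ltnNge (leq_trans ge) // kj subKn // mul2n doubleK.
rewrite big1 // => j jn; case: eqP => [kj|]; last by rewrite mulr0.
by rewrite kj leq_subr subKn // mul2n odd_double in h.
Qed.

Section ShortToric.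
Variables (R : rcfType) (n : nat).
Implicit Types (f q : {poly int}).

Definition ev q (y : R) := (map_poly intr q).[y].

Definition short_spec f q :=
  [/\ size q = n.+1, forall x : R, ev q x = (-1) ^+ n * ev q (- x) &
    forall x : R, 0 < x ->
      ev f x = Num.sqrt x ^+ n
               * (ev q (Num.sqrt x) + ev q (Num.sqrt x)^-1 - ev q 0)].

Let A q := q * 'X^n + \poly_(i < n.+1) q`_(n - i) - q`_0 *: 'X^n.

Let coefA q k : (A q)`_(n + k) = q`_k.
Proof.
rewrite coefB coefD coefMXn coefZ coefXn coef_poly ltnNge leq_addr /= addKn.
rewrite ltnS; case: k => [|k].
  by rewrite addn0 leqnn subnn eqxx mulr1 addrK.
have kn : (n < n + k.+1)%N by rewrite addnS ltnS leq_addr.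
by rewrite leqNgt kn gtn_eqF // mulr0 subr0 addr0.
Qed.

Let evA q y : y != 0 -> (size q <= n.+1)%N ->
  ev (A q) y = y ^+ n * (ev q y + ev q y^-1 - ev q 0).
Proof.
move=> y0 sq; rewrite /ev /A rmorphB rmorphD rmorphM /= map_polyZ map_polyXn.
rewrite !hornerE /= mulrBr mulrDr.
have -> : (map_poly intr q).[0] = intr q`_0 :> R by rewrite horner_coef0 coef_map.
congr (_ + _ - _); rewrite 1?[_ * y ^+ n]mulrC //.
have sz (p : {poly int}) : (size p <= n.+1)%N -> (size (map_poly intr p : {poly R}) <= n.+1)%N.
  by apply: leq_trans; apply: size_poly.
rewrite (horner_coef_wide _ (sz _ _)) ?size_poly //.
rewrite (horner_coef_wide _ (sz _ sq)) mulr_sumr (reindex_inj rev_ord_inj) /=.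
apply: eq_bigr => i _; rewrite subSS !coef_map coef_poly ltnS leq_subr.
have ilen : (i <= n)%N by rewrite -ltnS.
by rewrite subKn // mulrCA exprVn -expfB_cond // (negPf y0) add0n.
Qed.

Let evf f q : (forall x : R, 0 < x -> ev f x = ev q (Num.sqrt x)) ->
  f \Po 'X^2 = q.
Proof.
move=> h; apply/eqP; rewrite -subr_eq0; apply/eqP.
set p := _ - _.
apply: (@map_inj_poly _ R intr intr_inj) => //; rewrite rmorph0.
set pR := map_poly _ p.
pose rs := [seq i.+1%:R : R | i <- iota 0 (size pR)].
have := @roots_geq_poly_eq0 _ pR rs; apply; last by rewrite size_map size_iota.
  apply/allP => _ /mapP[i _ ->]; rewrite /root /pR rmorphB hornerD hornerN /=.
  rewrite map_comp_poly map_polyXn horner_comp hornerXn.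
  have := h (i.+1%:R ^+ 2); rewrite /ev sqrtr_sqr ger0_norm // => -> //.
    by rewrite subrr.
  by rewrite exprn_gt0.
by rewrite map_inj_uniq ?iota_uniq // => i j /eqP; rewrite eqr_nat => /eqP[].
Qed.

Lemma short_truncP f q :
  size f = n.+1 -> (forall i, (i <= n)%N -> f`_i = f`_(n - i)) ->
  short_spec f q <-> q = short_trunc n f.
Proof.
move=> sf sym; set s := short_trunc n f.
have ss : (size s <= n.+1)%N.
  by apply/leq_sizeP => j nj; rewrite coef_short_trunc leqNgt nj.
have As : A s = f \Po 'X^2.
  apply/polyP => m; rewrite coef_comp_poly_Xn // dvdn2 divn2.
  have [nm|mn] := leqP n m.
    rewrite -(subnKC nm) coefA coef_short_trunc; set k := (m - n)%N.
    case: (boolP (odd (n + k))) => [o|ev']; last first.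
      move: ((n + k)./2) (even_halfK ev') => j e.
      have <- : (n.*2 - (n + k) = n - k)%N by rewrite -addnn subnDl.
      rewrite -e -doubleB odd_double doubleK andbT -(leq_add2l n) addnn -e.
      rewrite leq_double.
      by case: leqP => [jn|nj]; [rewrite -sym|rewrite nth_default ?sf].
    by case: leqP => // kn; rewrite oddB // -oddD o.
  rewrite /A coefB coefD coefMXn coefZ coefXn coef_poly mn ltnS ltnW //.
  rewrite (ltn_eqF mn) mulr0 subr0 add0r coef_short_trunc leq_subr subKn //.
  exact: ltnW.
have specA (p : {poly int}) : (size p <= n.+1)%N ->
    (forall x : R, 0 < x ->
      ev f x = Num.sqrt x ^+ n
               * (ev p (Num.sqrt x) + ev p (Num.sqrt x)^-1 - ev p 0)) <->
    f \Po 'X^2 = A p.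
  move=> sp; split=> [h|h x x0].
    by apply: evf => x x0; rewrite evA ?h // gt_eqF // sqrtr_gt0.
  rewrite -evA ?gt_eqF ?sqrtr_gt0 // -h /ev map_comp_poly map_polyXn.
  by rewrite horner_comp hornerXn sqr_sqrtr // ltW.
split=> [[sq _ /specA qA]|->].
  apply/polyP => k; rewrite -coefA -[RHS]coefA As -qA //; by rewrite sq.
split; last exact/specA.
  have sn : s`_n != 0.
    rewrite coef_short_trunc leqnn subnn /= sym // subn0.
    by have := lead_coef_eq0 f; rewrite lead_coefE sf -size_poly_eq0 sf => ->.
  apply/eqP; rewrite eqn_leq ss ltnNge; apply: contra sn => /leq_sizeP/(_ n).
  by move=> ->.
move=> x; have sR : (size (map_poly intr s : {poly R}) <= n.+1)%N.
  exact: leq_trans (size_poly _ _) ss.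
rewrite /ev !(horner_coef_wide _ sR) mulr_sumr; apply: eq_bigr => k _.
rewrite coef_map coef_short_trunc /=; case: ifP => [/andP[kn ev_]|].
  have e : (-1) ^+ n * (-1) ^+ k = 1 :> R.
    by rewrite -exprD -signr_odd oddD -oddB // (negPf ev_).
  by rewrite (exprNn x k) mulrCA (mulrA _ _ (x ^+ k)) e mul1r.
by rewrite !mul0r mulr0.
Qed.
End ShortToric.

Lemma half_leqn n : (n./2 <= n)%N.
Proof. by rewrite -{2}(odd_double_half n) -addnn addnA leq_addl. Qed.

Lemma sum_subsets_exp (T : finType) (A : {set T}) :
  \sum_(B : {set T} | B \subset A) ('X - 1) ^+ (#|A| - #|B|) = 'X^#|A| :> {poly int}.
Proof.
rewrite (partition_big (fun B : {set T} => inord #|B| : 'I_#|A|.+1) predT) //=.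
rewrite -[in RHS](subrK 1 'X) exprDn; apply: eq_bigr => i _.
rewrite expr1n mulr1 -cards_draws -sumr_const; apply: eq_big => B.
  rewrite inE; case: (boolP (B \subset A)) => //= BA.
  by rewrite -val_eqE /= inordK // ltnS subset_leq_card.
by case/andP => BA /eqP <-; rewrite inordK // ltnS subset_leq_card.
Qed.

Lemma coef_sumXn k j : (\sum_(i < k) 'X^i : {poly int})`_j = (j < k)%:R.
Proof.
rewrite coef_sum; under eq_bigr do rewrite coefXn.
have [jk|kj] := ltnP j k.
  rewrite (bigD1 (Ordinal jk)) //= eqxx big1 ?addr0 // => i /eqP ij.
  by case: eqP => // ji; case: ij; apply: val_inj.
rewrite big1 // => i _; case: eqP => // ji.
by have := ltn_ord i; rewrite -ji ltnNge kj.
Qed.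

Lemma toric_f_boolean (r : nat) (A : {set 'I_r}) : A != set0 ->
  toric_f (@boolean_rank r) A = \sum_(i < #|A|) 'X^i.
Proof.
have [k] := ubnP #|A|; elim: k A => // k IH A lek A0.
have ltE (B C : {set 'I_r}) : (B < C)%O = (B \proper C).
  by rewrite lt_neqAle properEneq.
have cA : (0 < #|A|)%N by rewrite card_gt0.
rewrite toric_fE //.
transitivity (\sum_(B : {set 'I_r} | B \proper A) ('X - 1) ^+ (#|A| - 1 - #|B|)
   : {poly int}).
  apply: eq_big => B; rewrite ltE // => BA.
  rewrite /toric_g; case: ifP => [_|B0]; first by rewrite mul1r.
  have {}B0 : B != set0 by apply/negP => e; rewrite e in B0.
  have cB : (0 < #|B|)%N by rewrite card_gt0.
  rewrite IH //; last exact: leq_trans (proper_card BA) _.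
  suff -> : toric_trunc (boolean_rank B) (\sum_(i < #|B|) 'X^i) = 1 by rewrite mul1r.
  apply/polyP => j; rewrite coef_poly coef1 !coef_sumXn /boolean_rank.
  case: j => [|j]; first by rewrite cB subr0.
  rewrite coef_sumXn; case: ifP => //=; rewrite ltnS => jB.
  have jlt : (j.+1 < #|B|)%N.
    rewrite -[X in (_ < X)%N](prednK cB) ltnS (leq_trans jB) //.
    exact: half_leqn.
  by rewrite jlt (ltnW jlt) subrr.
have X1 : 'X - 1 != 0 :> {poly int} by rewrite polyXsubC_eq0.
apply: (mulfI X1); rewrite -subrX1 -sum_subsets_exp [in RHS](bigD1 A) //=.
rewrite subnn expr0 [1 + _]addrC addrK mulr_sumr; apply: eq_big => B.
  by rewrite properEneq andbC.
by move=> /proper_card BA; rewrite -exprS -subnDA add1n subnSK.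
Qed.

Lemma t_E (m : nat) : t_ m = \sum_(k < m./2.+1) 'X^(m - 2 * k).
Proof.
rewrite /t_ /short_toric toric_f_boolean; last first.
  by rewrite -card_gt0 cardsT card_ord.
rewrite /boolean_rank cardsT card_ord /=; set f := \sum_(i < _) _.
have sf : size f = m.+1.
  apply/eqP; rewrite eqn_leq; apply/andP; split.
    by apply/leq_sizeP => j mj; rewrite coef_sumXn ltnNge mj.
  rewrite ltnNge; apply/negP => /leq_sizeP/(_ m (leqnn _)).
  by rewrite coef_sumXn ltnSn.
rewrite /short_trunc sf.
have hm : (m./2.+1 <= m.+1)%N by rewrite ltnS half_leqn.
rewrite [RHS](big_ord_widen _ (fun k => 'X^(m - 2 * k)) hm).
apply: eq_big => [k|k _]; first by rewrite mul2n ltnS geq_half_double.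
by rewrite coef_sumXn ltn_ord scale1r.
Qed.

(* Main.v *)
(* Write e_p(y, w) for the form sum_{q <= p} (y - w)^(rho q) w^(rho p - rho q)
   minus y^(rho p).  Its coefficients are, up to sign, the differences
   h_i - h_(i-1) of the h-vector of the dual of [0, p], and it is antisymmetric
   by the Dehn-Sommerville relations.  Summation by parts turns the theorem into
   a formula for the coefficients of g([0, p), x), which says that
     g([0, p), x) = 1 - Res_{u=0} e_p((1 + u) / u, 1 + x u) / (u (1 + u) (1 + x u)) du.
   Since g is the only family of polynomials equal to 1 in rank 0, of degree
   < rank / 2 in positive rank, and satisfying
     sum_{p <= v} g([0, p), x) (x - 1)^(rho v - rho p) = x^(rho v) g([0, v), 1/x),
   it suffices to check this identity for the residue.  Boolean upper intervals give
     sum_p z^(rho v - rho p) e_p(y, w) = e_v(y+z, w+z) + e_v(w+z, z) + e_v(z, y+z),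
   and for y = (1 + u) / u, w = 1 + x u and z = x - 1 one has y + z = (1 + x u) / u
   and w + z = x (1 + u), so that the residues of the three terms are
   respectively x^(rho v) (1 - g(1/x)), e_v(x, x - 1) and 0. *)

Require Import Defs.
From HB Require Import structures.
From mathcomp Require Import all_boot all_order all_algebra.
From mathcomp Require Import ring zify.

Set Implicit Arguments.
Unset Strict Implicit.
Unset Printing Implicit Defensive.

Import Order.TTheory GRing.Theory Num.Theory.
Local Open Scope ring_scope.

(** * Ranks and binomial sums in Boolean upper intervals *)

Lemma sum_subsets_exprD (R : comNzRingType) (T : finType) (A : {set T}) (a b : R) :
  \sum_(B : {set T} | B \subset A) a ^+ #|B| * b ^+ (#|A| - #|B|)
  = (a + b) ^+ #|A|.
Proof.
rewrite (partition_big (fun B : {set T} => inord #|B| : 'I_#|A|.+1) predT) //=.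
rewrite addrC exprDn; apply: eq_bigr => i _.
rewrite mulrC -cards_draws -sumr_const; apply: eq_big => B.
  rewrite inE; case: (boolP (B \subset A)) => //= BA.
  by rewrite -val_eqE /= inordK // ltnS subset_leq_card.
by case/andP => BA /eqP <-; rewrite inordK // ltnS subset_leq_card.
Qed.

Section DualSimplicial.
Variables (d : Order.disp_t) (P : finTBPOrderType d) (rho : P -> nat).
Hypothesis rho_graded : graded rho.
Implicit Types p q v : P.

Lemma rank_le p v : (p <= v)%O -> (rho p <= rho v)%N.
Proof.
rewrite le_eqVlt => /orP[/eqP-> //|pv].
by apply: ltnW; apply: graded_lt.
Qed.

(** Nothing assumes that [phi] respects ranks. Deleting one point from [phi p] gives an element
    covered by [p], since no set fits strictly between nested sets whose sizes differ by one. *)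
Lemma rank_boolean k q (phi : P -> {set 'I_k}) :
    {in [pred z | (q <= z <= \top)%O] &,
      forall x y, (x <= y)%O = (phi x \subset phi y)} ->
    (forall A : {set 'I_k}, exists2 x, (q <= x <= \top)%O & phi x = A) ->
  forall p, (q <= p)%O -> rho p = (rho q + #|phi p|)%N.
Proof.
move=> phi_le phi_surj.
have phi_leE x y : (q <= x)%O -> (q <= y)%O -> (x <= y)%O = (phi x \subset phi y).
  by move=> qx qy; apply: phi_le; rewrite inE ?qx ?qy lex1.
have phi_inj x y : (q <= x)%O -> (q <= y)%O -> phi x = phi y -> x = y.
  by move=> qx qy e; apply: le_anti; rewrite (phi_leE x y) ?(phi_leE y x) ?e ?subxx.
move=> p; move: {2}#|phi p| (erefl #|phi p|) => m.
elim: m p => [|m IH] p cp qp.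
  have pq : (p <= q)%O by rewrite phi_leE // (cards0_eq cp) sub0set.
  by rewrite cp addn0; congr rho; apply: le_anti; rewrite pq qp.
have /card_gt0P[i ip] : (0 < #|phi p|)%N by rewrite cp.
have [p' /andP[qp' _] phip'] := phi_surj (phi p :\ i).
have cp' : #|phi p'| = m by move: cp; rewrite (cardsD1 i) ip phip' => -[].
rewrite cp addnS -cp' -IH //.
have [_ rho_cov] := rho_graded; apply: rho_cov; apply/andP; split.
  rewrite lt_neqAle phi_leE // phip' subsetDl andbT.
  by apply: contraTneq ip => <-; rewrite phip' !inE eqxx.
apply/forallP => z; apply/negP => /andP[p'z zp].
have qz : (q <= z)%O by apply: le_trans qp' (ltW p'z).
have sub1 : phi p' \proper phi z.
  rewrite properEneq -phi_leE // (ltW p'z) andbT.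
  by apply: contraTneq p'z => /(phi_inj _ _ qp' qz) ->; rewrite ltxx.
have sub2 : phi z \proper phi p.
  rewrite properEneq -phi_leE // (ltW zp) andbT.
  by apply: contraTneq zp => /(phi_inj _ _ qz qp) ->; rewrite ltxx.
have := proper_card sub1; have := proper_card sub2; rewrite cp cp'; lia.
Qed.

Hypothesis P_dual_simplicial : dual_simplicial P.

(** Inside the Boolean interval from [q] to the top, the elements below [v] are the subsets of
    [phi v], so the sum is a binomial expansion. *)
Lemma sum_interval (R : comNzRingType) q v (a b : R) :
    q != \bot%O -> (q <= v)%O ->
  \sum_(p | (q <= p <= v)%O) a ^+ (rho p - rho q) * b ^+ (rho v - rho p)
  = (a + b) ^+ (rho v - rho q).
Proof.
move=> /P_dual_simplicial[k [phi [phi_le phi_surj]]] qv.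
have rk := rank_boolean phi_le phi_surj.
have phi_leE x y : (q <= x)%O -> (q <= y)%O -> (x <= y)%O = (phi x \subset phi y).
  by move=> qx qy; apply: phi_le; rewrite inE ?qx ?qy lex1.
rewrite (rk v) // addKn -sum_subsets_exprD.
have -> : \sum_(B : {set 'I_k} | B \subset phi v) a ^+ #|B| * b ^+ (#|phi v| - #|B|)
   = \sum_(B in phi @: [set p | (q <= p <= v)%O]) a ^+ #|B| * b ^+ (#|phi v| - #|B|).
  apply: eq_bigl => B; apply/idP/imsetP => [Bv|[p]].
    have [p /andP[qp _] pB] := phi_surj B; exists p => //.
    by rewrite inE qp phi_leE // pB.
  by rewrite inE => /andP[qp pv] ->; rewrite -phi_leE.
rewrite big_imset /=; last first.
  move=> x y; rewrite !inE => /andP[qx _] /andP[qy _] e.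
  by apply: le_anti; rewrite (phi_leE x y) ?(phi_leE y x) ?e ?subxx.
apply: eq_big => [p|p /andP[qp pv]]; first by rewrite inE.
by rewrite (rk p) // addKn subnDl.
Qed.

(** * The form: Dehn-Sommerville antisymmetry and summation over the poset *)

Hypothesis P_eulerian : eulerian rho.

Lemma sum_sign_below (R : comNzRingType) v : v != \bot%O ->
  \sum_(q | (q <= v)%O) (-1) ^+ rho q = 0 :> R.
Proof.
move=> v0; have : (\bot < v :> P)%O by rewrite lt0x.
move=> /P_eulerian/(congr1 (fun c : int => c%:~R : R)).
rewrite rmorph_sum => e; rewrite -[RHS]e; apply: eq_big => [q|q _]; first by rewrite le0x.
by rewrite rmorphXn /= rmorphN1.
Qed.

(** The form e_v is this minus [y ^+ rho v]. The ring varies because the form is evaluated both at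
    numbers and at polynomials. *)
Definition face_form (R : comNzRingType) v (y w : R) : R :=
  \sum_(q | (q <= v)%O) (y - w) ^+ rho q * w ^+ (rho v - rho q).

Lemma face_formE (R : comNzRingType) v (y w : R) :
  face_form v y w = w ^+ rho v
    + \sum_(q | (q <= v)%O && (q != \bot%O)) (y - w) ^+ rho q * w ^+ (rho v - rho q).
Proof.
have [rho0 _] := rho_graded.
by rewrite /face_form (bigD1 \bot%O) ?le0x //= rho0 expr0 mul1r subn0.
Qed.

(** Expanding y = (y - w) + w by [sum_interval] introduces a sum over [p] in [q, v]. After the
    exchange of sums, the signs of the nonbottom [q <= p] add up to -1 by the Euler relation. *)
Lemma face_formC (R : comNzRingType) v (y w : R) : v != \bot%O ->
  face_form v w y = y ^+ rho v + w ^+ rho v - face_form v y w.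
Proof.
move=> v0; rewrite !face_formE.
have -> (a b s : R) : a + b - (b + s) = a + - s by ring.
congr (_ + _); rewrite -sumrN.
transitivity (\sum_(q | (q <= v)%O && (q != \bot%O))
   \sum_(p | (q <= p <= v)%O)
      (-1) ^+ rho q * ((y - w) ^+ rho p * w ^+ (rho v - rho p))).
  apply: eq_bigr => q /andP[qv q0].
  have {2}-> : y = (y - w) + w by ring.
  rewrite -sum_interval // mulr_sumr; apply: eq_bigr => p /andP[qp pv].
  rewrite -(opprB y w) (exprNn (y - w)) !mulrA; congr (_ * _); rewrite -mulrA -exprD subnKC //.
  exact: rank_le.
rewrite (exchange_big_dep (fun p => (p <= v)%O && (p != \bot%O))) /=; last first.
  move=> q p /andP[qv q0] /andP[qp ->] /=; apply: contraNneq q0 => p0.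
  by move: qp; rewrite p0 lex0.
apply: eq_bigr => p /andP[pv p0]; rewrite -mulr_suml.
rewrite -[RHS]mulN1r; congr (_ * _); apply/eqP; rewrite -addr_eq0 addrC.
have [rho0 _] := rho_graded.
apply/eqP; rewrite -[RHS](sum_sign_below R p0) [RHS](bigD1 \bot%O) ?le0x //=.
rewrite rho0 expr0; congr (_ + _); apply: eq_bigl => q.
rewrite pv andbT; case: (boolP (q <= p)%O) => qp; last by rewrite andbF.
by rewrite (le_trans qp pv) andbT.
Qed.

(** For nonbottom [q], summing over [p] in [q, v] replaces w by w + z and keeps y - w. The bottom
    terms and the subtracted powers give forms with second argument z; antisymmetry makes the result
    cyclic. *)
Lemma sum_face_form (R : comNzRingType) v (y w z : R) : v != \bot%O ->
  let e u s := face_form v u s - u ^+ rho v in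
  \sum_(p | (p <= v)%O) z ^+ (rho v - rho p) * (face_form p y w - y ^+ rho p)
  = e (y + z) (w + z) + e (w + z) z + e z (y + z).
Proof.
move=> v0 e; rewrite /e (face_formC (y + z) z v0).
have sumE s : \sum_(p | (p <= v)%O) z ^+ (rho v - rho p) * s ^+ rho p
   = face_form v (s + z) z.
  by rewrite /face_form; apply: eq_bigr => p _; rewrite addrK mulrC.
under eq_bigr do rewrite mulrBr.
rewrite sumrB sumE.
have -> : \sum_(p | (p <= v)%O) z ^+ (rho v - rho p) * face_form p y w =
  face_form v (w + z) z + (face_form v (y + z) (w + z) - (w + z) ^+ rho v).
  under eq_bigr do rewrite face_formE mulrDr.
  rewrite big_split /= sumE; congr (_ + _).
  rewrite face_formE [RHS]addrC addKr.
  under eq_bigr do rewrite mulr_sumr.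
  rewrite (exchange_big_dep (fun q => (q <= v)%O && (q != \bot%O))) /=; last first.
    by move=> p q pv /andP[qp ->]; rewrite (le_trans qp pv).
  apply: eq_bigr => q /andP[qv q0].
  rewrite -sum_interval // mulr_sumr; apply: eq_big => [p|p /andP[pv /andP[qp _]]].
    by rewrite q0 andbT andbC.
  by rewrite opprD addrACA subrr addr0; ring.
by ring.
Qed.
End DualSimplicial.

(** * Residues computed as coefficients of polynomials *)

Section ResidueFunctional.
Variables (R : comNzRingType) (x : R) (M : nat).
Implicit Types (c : R) (F : {poly R}).

Local Notation lin c := (1 + c%:P * 'X : {poly R}).

(* The values found in [residue_below] and [residue_above]: [weight r i] is a
   polynomial in [x] and [coweight r i] is [x ^+ r] times its value at [x^-1]. *)
Definition weight (r i : nat) : R :=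
  \sum_(1 <= k < i.+1) x ^+ k *+ ('C(r.-1 - i, k) * 'C(i.-1, k.-1)).

Definition coweight (r i : nat) : R :=
  \sum_(1 <= k < i.+1) x ^+ (r - k) *+ ('C(r.-1 - i, k) * 'C(i.-1, k.-1)).

(** The power series 1 / (1 + c 'X) modulo ['X^M]. *)
Definition geom c : {poly R} := \poly_(m < M) (- c) ^+ m.

(* For [r < M], the coefficient of ['X^r] in the power series
   [F / ((1 + 'X) (1 + x 'X))]. *)
Definition residue (r : nat) F : R := (geom 1 * geom x * F)`_r.

Lemma coef_lin_exp c n k : (lin c ^+ n)`_k = c ^+ k *+ 'C(n, k).
Proof.
rewrite exprDn coef_sum.
have E i : (1 ^+ (n - i) * (c%:P * 'X) ^+ i *+ 'C(n, i) : {poly R})`_k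
    = (c ^+ i *+ 'C(n, i)) * (k == i)%:R.
  by rewrite expr1n mul1r coefMn exprMn -rmorphXn coefCM coefXn mulrnAl.
under eq_bigr do rewrite E.
have [kn|nk] := leqP k n.
  rewrite (bigD1 (Ordinal (kn : (k < n.+1)%N))) //= eqxx mulr1 big1 ?addr0 // => i ik.
  case: eqP => [ki|]; last by rewrite mulr0.
  by case/eqP: ik; apply: val_inj.
rewrite bin_small // mulr0n big1 // => i _; case: eqP => [ki|]; last by rewrite mulr0.
by have := ltn_ord i; rewrite -ki ltnS leqNgt nk.
Qed.

Lemma lin_geom c : lin c * geom c = 1 - (- (c%:P * 'X)) ^+ M.
Proof.
rewrite -[RHS]opprB subrX1 /geom poly_def.
have -> : \sum_(i < M) (- c) ^+ i *: 'X^i = \sum_(i < M) (- (c%:P * 'X)) ^+ i.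
  by apply: eq_bigr => i _; rewrite -mulNr -polyCN exprMn -rmorphXn /= mul_polyC.
by ring.
Qed.

Lemma coef_1subXM c F j : (j < M)%N ->
  ((1 - (- (c%:P * 'X)) ^+ M) * F)`_j = F`_j.
Proof.
move=> jM; rewrite mulrBl mul1r coefB exprNn exprMn -rmorphXn /=.
have -> : (-1) ^+ M * ((c ^+ M)%:P * 'X^M) * F
  = (-1) ^+ M * (c ^+ M)%:P * F * 'X^M by ring.
by rewrite coefMXn jM subr0.
Qed.

Lemma residue_lin r F : (r < M)%N ->
  residue r (lin 1 * lin x * F) = F`_r.
Proof.
move=> rM; rewrite /residue.
have -> : geom 1 * geom x * (lin 1 * lin x * F)
  = (lin 1 * geom 1) * ((lin x * geom x) * F) by ring.
by rewrite !lin_geom !coef_1subXM.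
Qed.

(** Brings residues of different orders [s] to one order [r], so that a sum over the poset can be
    taken inside a single residue. *)
Lemma residue_shift r s c F : (s <= r)%N ->
  residue r ((c%:P * 'X) ^+ (r - s) * F) = c ^+ (r - s) * residue s F.
Proof.
move=> sr; rewrite /residue exprMn -rmorphXn /=.
have -> : geom 1 * geom x * ((c ^+ (r - s))%:P * 'X^(r - s) * F) =
  (c ^+ (r - s))%:P * (geom 1 * geom x * F * 'X^(r - s)) by ring.
by rewrite coefCM coefMXn ltnNge leq_subr subKn.
Qed.

Lemma residue_sum r I (s : seq I) (Q : pred I) (F : I -> {poly R}) :
  residue r (\sum_(i <- s | Q i) F i) = \sum_(i <- s | Q i) residue r (F i).
Proof. by rewrite /residue mulr_sumr coef_sum. Qed.

Lemma residueMz r F (n : int) : residue r (F *~ n) = residue r F *~ n.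
Proof. by rewrite /residue mulrzAr coefMrz. Qed.

Lemma residueD r F G : residue r (F + G) = residue r F + residue r G.
Proof. by rewrite /residue mulrDr coefD. Qed.

Lemma weightE r i : (0 < i < r)%N ->
  (lin 1 ^+ i.-1 * lin x ^+ (r - i).-1)`_i = weight r i.
Proof.
case: i => // i /= ir; rewrite coefMr big_ord_recl /= subn0 coef_lin_exp.
(* The term k = 0 vanishes: a power with exponent i - 1 has no coefficient of degree i. *)
rewrite bin_small // mulr0n mul0r add0r /weight big_add1 big_mkord.
apply: eq_bigr => k _; rewrite !coef_lin_exp /= /bump /= add1n subSS.
rewrite expr1n bin_sub; last by rewrite -ltnS.
rewrite mulr_natl -mulrnA; congr (_ *+ (_ * _)); congr 'C(_, _).
by rewrite -subn1 -subnDA addn1 -subn1 -subnDA add1n.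
Qed.

Lemma coweightE r i : (0 < i < r)%N ->
  x ^+ (r - i) * (lin x ^+ i.-1 * lin 1 ^+ (r - i).-1)`_i = coweight r i.
Proof.
case: i => // i /= ir; rewrite coefMr big_ord_recl /= subn0 coef_lin_exp.
rewrite bin_small // mulr0n mul0r add0r /coweight big_add1 big_mkord mulr_sumr.
apply: eq_bigr => k _; rewrite !coef_lin_exp /= /bump /= add1n subSS.
have ki : (k <= i)%N by rewrite -ltnS.
rewrite expr1n bin_sub // mulr_natr -mulrnA mulrnAr -exprD.
congr (_ ^+ _ *+ _); first lia.
by rewrite mulnC; congr ('C(_, _) * _)%N; lia.
Qed.

(** Both exponents are positive, so one factor of each kind cancels the denominator, and the power
    of ['X] lowers the degree read from r to i. *)
Lemma residue_below r i : (0 < i < r)%N -> (r < M)%N ->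
  residue r (lin 1 ^+ i * ('X * lin x) ^+ (r - i)) = weight r i.
Proof.
move=> ir rM; rewrite -weightE //.
case: i ir => // i ir; case e : (r - i.+1)%N => [|j] /=; first lia.
rewrite exprMn.
have -> : lin 1 ^+ i.+1 * ('X^(j.+1) * lin x ^+ j.+1) =
  (1%:P * 'X) ^+ (r - i.+1) * (lin 1 * lin x * (lin 1 ^+ i * lin x ^+ j)).
  by rewrite e polyC1 mul1r !exprS; ring.
rewrite residue_shift; last lia.
by rewrite expr1n mul1r residue_lin //; lia.
Qed.

Lemma residue_above r i : (0 < i < r)%N -> (r < M)%N ->
  residue r (lin x ^+ i * (x%:P * 'X * lin 1) ^+ (r - i)) = coweight r i.
Proof.
move=> ir rM; rewrite -coweightE //.
case: i ir => // i ir; case e : (r - i.+1)%N => [|j] /=; first lia.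
rewrite exprMn.
have -> : lin x ^+ i.+1 * ((x%:P * 'X) ^+ j.+1 * lin 1 ^+ j.+1) =
  (x%:P * 'X) ^+ (r - i.+1) * (lin 1 * lin x * (lin x ^+ i * lin 1 ^+ j)).
  by rewrite e !exprS; ring.
rewrite residue_shift; last lia.
by rewrite e residue_lin //; lia.
Qed.

Lemma residue0 F : (0 < M)%N -> residue 0 F = F`_0.
Proof.
move=> M0; have g c : (geom c)`_0 = 1.
  by rewrite coef_poly M0.
by rewrite /residue !coef0M !g !mul1r.
Qed.

(** All r factors carry an ['X], so only constant terms survive. *)
Lemma residue_top r i : (i <= r)%N -> (0 < M)%N ->
  residue r ((x%:P * 'X * lin 1) ^+ i * ((x - 1)%:P * 'X) ^+ (r - i))
  = x ^+ i * (x - 1) ^+ (r - i).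
Proof.
move=> ir M0; rewrite mulrC residue_shift // mulrC; congr (_ * _).
have := residue_shift x (lin 1 ^+ i) (leq0n i); rewrite subn0 -exprMn => ->.
by rewrite residue0 // coef_lin_exp expr0 bin0 mulr1.
Qed.

(** After cancelling 1 + x 'X, the coefficient is an alternating binomial sum. Its value is
    independent of [i], so these terms cancel in the total. *)
Lemma residue_cancel r i : (0 < i < r)%N -> (r < M)%N ->
  residue r (((x - 1)%:P * 'X) ^+ i * lin x ^+ (r - i)) = - (x - 1) ^+ r.-1.
Proof.
move=> ir rM; set j := (r - i)%N; have -> : i = (r - j)%N by rewrite /j; lia.
rewrite residue_shift; last by rewrite /j; lia.
case e : j => [|k]; first by rewrite /j in e; lia.
have kM : (k.+1 < M)%N by rewrite -e /j; lia.
have -> : r.-1 = (r - k.+1 + k)%N by rewrite -e /j; move: e; rewrite /j; lia.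
rewrite exprD -mulrN; congr (_ * _).
rewrite /residue exprS.
have -> : geom 1 * geom x * (lin x * lin x ^+ k) =
  (lin x * geom x) * (geom 1 * lin x ^+ k) by ring.
rewrite lin_geom coef_1subXM //.
rewrite coefMr big_ord_recr /= coef_lin_exp bin_small // mulr0n mulr0 addr0.
rewrite (addrC x) [(-1 + x) ^+ k]exprDn -sumrN; apply: eq_bigr => l _; have lk := ltn_ord l.
rewrite coef_lin_exp coef_poly ifT; last lia.
by rewrite mulrnAr subSn // exprS !mulNr mul1r mulNrn.
Qed.
End ResidueFunctional.

(** * Integer coefficients of the form and the closed expression for g *)

Lemma homogenize_XsubC_exp (R : comNzRingType) (y w : R) k r : (k <= r)%N ->
  \sum_(i < r.+1) (y ^+ i * w ^+ (r - i)) *~ (('X - 1 : {poly int}) ^+ k)`_i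
  = (y - w) ^+ k * w ^+ (r - k).
Proof.
elim: k r => [|k IH] r kr.
  rewrite big_ord_recl big1 => [|i _]; first by rewrite addr0 coef1 !expr0 subn0.
  by rewrite coef1 mulr0z.
case: r kr => // r; rewrite ltnS => kr.
have coefE i : (('X - 1 : {poly int}) ^+ k.+1)`_i
   = (if i is j.+1 then (('X - 1) ^+ k)`_j else 0) - (('X - 1) ^+ k)`_i.
  by rewrite exprS mulrBl mul1r coefB coefXM; case: i.
under eq_bigr do rewrite coefE mulrzBr.
rewrite sumrB big_ord_recl mulr0z add0r [X in _ - X]big_ord_recr /=.
have -> : (('X - 1 : {poly int}) ^+ k)`_r.+1 = 0.
  by apply: nth_default; rewrite size_exp_XsubC ltnS.
rewrite mulr0z addr0 subSS exprS -mulrA -IH // mulrBl !mulr_sumr.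
congr (_ - _); apply: eq_bigr => i _; rewrite mulrzAr; congr (_ *~ _).
  by rewrite /bump /= add1n subSS exprS mulrA.
by rewrite subSn ?exprS -1?ltnS //; ring.
Qed.

Section ToricG.
Variables (d : Order.disp_t) (P : finTBPOrderType d) (rho : P -> nat).
Hypotheses (rho_graded : graded rho) (P_eulerian : eulerian rho).
Hypothesis P_dual_simplicial : dual_simplicial P.
Implicit Types p q v : P.

Definition face_coef v (i : nat) : int := (face_form rho v 'X 1 : {poly int})`_i.

(** By homogeneity, one family of integers describes the form in every ring. *)
Lemma face_form_coef (R : comNzRingType) v (y w : R) :
  face_form rho v y w
  = \sum_(i < (rho v).+1) (y ^+ i * w ^+ (rho v - i)) *~ face_coef v i.
Proof.
rewrite /face_coef {2}/face_form /face_form.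
under [RHS]eq_bigr do rewrite coef_sum mulrz_sumr.
rewrite exchange_big /=; apply: eq_bigr => q qv.
rewrite -homogenize_XsubC_exp ?rank_le //.
by apply: eq_bigr => i _; rewrite expr1n mulr1.
Qed.

Lemma rank_gt0 v : v != \bot%O -> (0 < rho v)%N.
Proof. by rewrite -lt0x => /(graded_lt rho_graded); have [-> _] := rho_graded. Qed.

(** Evaluation at (y, w) = (0, 1) gives the Euler relation; [face_coef_top] and [sum_face_coef]
    evaluate at (1, 0) and (1, 1). *)
Lemma face_coef0 v : v != \bot%O -> face_coef v 0 = 0.
Proof.
move=> v0; have <- := sum_sign_below P_eulerian int v0.
transitivity (face_form rho v 0 1 : int).
  rewrite face_form_coef big_ord_recl big1 ?addr0 => [|i _].
    by rewrite !expr0 expr1n mulr1 intz.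
  by rewrite expr0n /= mul0r mul0rz.
by apply: eq_bigr => q _; rewrite expr1n mulr1 sub0r.
Qed.

Lemma face_coef_top v : face_coef v (rho v) = 1.
Proof.
transitivity (face_form rho v 1 0 : int).
  rewrite face_form_coef big_ord_recr /= big1 ?add0r => [|i _].
    by rewrite subnn expr1n expr0 mulr1 intz.
  by rewrite expr0n subn_eq0 leqNgt ltn_ord /= mulr0 mul0rz.
rewrite /face_form (bigD1 v) //= big1 ?addr0 => [|q /andP[qv nqv]].
  by rewrite ?subr0 expr1n subnn expr0 mulr1.
have qlt : (q < v)%O by rewrite lt_neqAle nqv.
by rewrite expr0n subn_eq0 leqNgt (graded_lt rho_graded) //= mulr0.
Qed.

Lemma sum_face_coef v : \sum_(i < (rho v).+1) face_coef v i = 1.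
Proof.
transitivity (face_form rho v 1 1 : int).
  by rewrite face_form_coef; apply: eq_bigr => i _; rewrite !expr1n mulr1 intz.
rewrite face_formE // big1 ?addr0 ?expr1n // => q /andP[_ /rank_gt0 q0].
by rewrite subrr expr0n gtn_eqF // mul0r.
Qed.

(** Coefficient of ['X^i] in the antisymmetry relation at y = 'X, w = 1; the two pure powers do not
    reach this degree. *)
Lemma face_coef_sym v i : (0 < i < rho v)%N ->
  face_coef v (rho v - i) = - face_coef v i.
Proof.
move=> iv; have v0 : v != \bot%O.
  by apply/negP => /eqP e; move: iv; rewrite e (proj1 rho_graded); lia.
have := congr1 (coefp i) (face_formC rho_graded P_dual_simplicial P_eulerian 'X (1 : {poly int}) v0).
rewrite /= coefB coefD coefXn expr1n coef1.
rewrite -[X in _ - X]/(face_coef v i) => e.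
have eS : face_coef v (rho v - i) = (face_form rho v 1 'X : {poly int})`_i.
  rewrite face_form_coef coef_sum.
  have ilt : (rho v - i < (rho v).+1)%N by lia.
  rewrite (bigD1 (Ordinal ilt)) //= big1 => [|j /eqP ij].
    rewrite expr1n mul1r coefMrz coefXn addr0.
    have -> : i == (rho v - (rho v - i))%N by lia.
    by rewrite intz.
  rewrite expr1n mul1r coefMrz coefXn; case: eqP => [ei|]; last by rewrite mul0rz.
  by case: ij; apply: val_inj => /=; have := ltn_ord j; lia.
rewrite eS e; have -> : (i == rho v) = false by lia.
rewrite gtn_eqF; last by case/andP: iv.
by rewrite addr0 add0r.
Qed.

Lemma face_form_inner (R : comNzRingType) v (y w : R) :
  face_form rho v y w - y ^+ rho v
  = \sum_(1 <= i < rho v) (y ^+ i * w ^+ (rho v - i)) *~ face_coef v i.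
Proof.
rewrite face_form_coef big_ord_recr /= face_coef_top subnn expr0 mulr1 addrK.
have [->|v0] := eqVneq v \bot%O.
  by rewrite (proj1 rho_graded) big_ord0 big_geq.
rewrite -(big_mkord predT (fun i => (y ^+ i * w ^+ (rho v - i)) *~ face_coef v i)).
by rewrite [LHS]big_ltn ?rank_gt0 //= face_coef0 // mulr0z add0r.
Qed.

(** One minus the residue of e_v, taken monomial by monomial. *)
Definition gpoly (R : comNzRingType) (x : R) v : R :=
  1 - \sum_(1 <= i < rho v) weight x (rho v) i *~ face_coef v i.

(* The defining identity of a Kazhdan-Lusztig-Stanley function. *)
Lemma sum_gpoly (R : comNzRingType) (x : R) v : v != \bot%O ->
  \sum_(p | (p <= v)%O) gpoly x p * (x - 1) ^+ (rho v - rho p)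
  = x ^+ rho v - \sum_(1 <= i < rho v) coweight x (rho v) i *~ face_coef v i.
Proof.
(* Every residue below has order at most [rho v], so one truncation serves all. *)
move=> v0; pose M := (rho v).+1.
pose a : {poly R} := 1 + 1%:P * 'X; pose b : {poly R} := 1 + x%:P * 'X.
pose z : {poly R} := (x - 1)%:P * 'X.
(* ['X] is the residue variable [u]; [a], ['X * b] and [z] are [u] times the
   [y], [w] and [z = x - 1] at which the form is evaluated. *)
have gE p : (p <= v)%O ->
    gpoly x p = 1 - residue x M (rho p) (face_form rho p a ('X * b) - a ^+ rho p).
  move=> pv; rewrite /gpoly face_form_inner residue_sum.
  congr (1 - _); apply: eq_big_nat => i ip; rewrite residueMz residue_below //.
  by rewrite ltnS rank_le.
have E1 : \sum_(p | (p <= v)%O) (x - 1) ^+ (rho v - rho p) = face_form rho v x (x - 1).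
  by apply: eq_bigr => p _; rewrite opprB addrCA subrr addr0 expr1n mul1r.
transitivity (\sum_(p | (p <= v)%O) (x - 1) ^+ (rho v - rho p)
   - residue x M (rho v) (\sum_(p | (p <= v)%O)
       z ^+ (rho v - rho p) * (face_form rho p a ('X * b) - a ^+ rho p))).
  rewrite residue_sum -sumrB; apply: eq_bigr => p pv.
  by rewrite gE // residue_shift ?rank_le // mulrBl mul1r mulrC.
rewrite E1 sum_face_form //; cbv zeta.
have -> : a + z = b by rewrite /a /b /z polyCB; ring.
have -> : 'X * b + z = x%:P * 'X * a by rewrite /a /b /z polyCB polyC1; ring.
rewrite !face_form_inner !residueD !residue_sum.
rewrite (eq_big_nat _ _ (F2 := fun i => coweight x (rho v) i *~ face_coef v i)); last first.
  by move=> i iv; rewrite residueMz residue_above.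
rewrite [X in _ - (_ + X + _)](eq_big_nat _ _
    (F2 := fun i => (x ^+ i * (x - 1) ^+ (rho v - i)) *~ face_coef v i)); last first.
  by move=> i /andP[_ iv]; rewrite residueMz residue_top // ltnW.
rewrite [X in _ - (_ + _ + X)](eq_big_nat _ _
    (F2 := fun i => (- (x - 1) ^+ (rho v).-1) *~ face_coef v i)); last first.
  by move=> i iv; rewrite residueMz residue_cancel.
(* The inner coefficients sum to 0: the total is 1, the top one is 1 and the bottom one is 0. *)
have -> : \sum_(1 <= i < rho v) (- (x - 1) ^+ (rho v).-1) *~ face_coef v i = 0.
  rewrite -mulrz_sumr.
  suff -> : \sum_(1 <= i < rho v) face_coef v i = 0 by rewrite mulr0z.
  have := sum_face_coef v; rewrite big_ord_recr /= face_coef_top -{2}[1]add0r.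
  move=> /addIr; rewrite -(big_mkord predT (face_coef v)).
  by rewrite [X in X = _ -> _]big_ltn ?rank_gt0 //= face_coef0 // add0r.
(* The second sum is e_v(x, x - 1); against [E1] it leaves x ^+ rho v. *)
rewrite -face_form_inner; ring.
Qed.
End ToricG.

(** * Degree bounds for the weights; short toric polynomials in the basis [t_] *)

Lemma coef_weight r i k : (0 < i)%N ->
  (weight ('X : {poly int}) r i)`_k
  = if k == 0%N then 0 else ('C(r.-1 - i, k) * 'C(i.-1, k.-1))%N%:Z.
Proof.
move=> i0; rewrite /weight coef_sum.
under eq_bigr do rewrite coefMn coefXn.
have [->|k0] := eqVneq k 0%N.
  by rewrite big_nat big1 // => j /andP[j0 _]; rewrite ltn_eqF ?mul0rn.
have [ki|ik] := leqP k i.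
  rewrite (@big_cat_nat _ _ _ k) ?lt0n //=; last exact: leqW.
  rewrite big_nat big1 => [|j /andP[_ jk]]; last by rewrite gtn_eqF // mul0rn.
  rewrite add0r big_ltn ?ltnS // eqxx big_nat big1 => [|j /andP[jk _]].
    by rewrite addr0 -natz.
  by rewrite ltn_eqF // mul0rn.
rewrite (@bin_small i.-1); last lia.
by rewrite muln0 big_nat big1 // => j /andP[_ ji]; rewrite gtn_eqF ?mul0rn //; lia.
Qed.

(** Nonzero binomials force k <= r - 1 - i and k <= i, hence 2k <= r - 1. Dually, coweights live
    strictly above the middle degree. *)
Lemma coef_weight_high r i k : (0 < i < r)%N -> (r.-1./2 < k)%N ->
  (weight ('X : {poly int}) r i)`_k = 0.
Proof.
move=> ir rk; rewrite coef_weight; last lia.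
case: eqP => // _.
have [lt|ge] := ltnP (r.-1 - i) k; first by rewrite (bin_small lt).
by rewrite (@bin_small i.-1) ?muln0 //; lia.
Qed.

Lemma coef_coweight_low r i k : (i < r)%N -> (k <= r.-1./2)%N ->
  (coweight ('X : {poly int}) r i)`_k = 0.
Proof.
move=> ir kr; rewrite /coweight coef_sum big_nat big1 // => j /andP[j0 ji].
rewrite coefMn coefXn; case: eqP => [kE|_]; last by rewrite mul0rn.
by rewrite (@bin_small (r.-1 - i)) ?mul0n //; lia.
Qed.

Lemma coef_t_ (m j : nat) : (t_ m)`_j = ((j <= m) && ~~ odd (m - j))%N%:R.
Proof.
rewrite /t_ /short_toric toric_f_boolean; last first.
  by rewrite -card_gt0 cardsT card_ord.
rewrite /boolean_rank cardsT card_ord /= coef_short_trunc.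
case: ifP => // _; rewrite coef_sumXn.
by have -> : ((m - j)./2 < m.+1)%N by lia.
Qed.

(** The coefficients of [toric_trunc] are differences of those of [f]. Each [t_] with index n - 2k
    >= j of the same parity contributes 1 in degree j, so the sum telescopes. *)
Lemma short_truncE n (f : {poly int}) :
  short_trunc n f
  = \sum_(0 <= k < n./2.+1) (toric_trunc n.+1 f)`_k *: t_ (n%:Z - (2 * k)%N%:Z).
Proof.
apply/polyP => j; rewrite coef_short_trunc coef_sum.
have partial s : (s <= n./2)%N ->
    \sum_(0 <= k < s.+1) (toric_trunc n.+1 f)`_k = f`_s.
  elim: s => [|s IH] sn; first by rewrite big_nat1 coef_poly /= subr0.
  by rewrite big_nat_recr //= IH ?(ltnW sn) // coef_poly /= ltnS sn addrC subrK.
transitivity (\sum_(0 <= k < n./2.+1) (toric_trunc n.+1 f)`_k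
   * ((j <= n - 2 * k) && ~~ odd (n - 2 * k - j))%N%:R); last first.
  apply: eq_big_nat => k kn; rewrite coefZ.
  by rewrite (@subzn n (2 * k)) ?coef_t_ //; lia.
case: ifP => [/andP[jn ev]|H]; last first.
  rewrite big_nat big1 // => k kn.
  have -> : ((j <= n - 2 * k) && ~~ odd (n - 2 * k - j))%N = false by lia.
  by rewrite mulr0.
rewrite -partial; last by lia.
rewrite [RHS](@big_cat_nat _ _ _ (n - j)./2.+1) //=; last by lia.
rewrite [X in _ + X]big_nat [X in _ + X]big1 => [|k kn]; last first.
  have -> : ((j <= n - 2 * k) && ~~ odd (n - 2 * k - j))%N = false by lia.
  by rewrite mulr0.
rewrite addr0; apply: eq_big_nat => k kn.
have -> : ((j <= n - 2 * k) && ~~ odd (n - 2 * k - j))%N by lia.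
by rewrite mulr1.
Qed.

(** * Identification of g, and the toric h-vector of the dual *)

Section Toric.
Variables (d : Order.disp_t) (P : finTBPOrderType d) (rho : P -> nat).
Hypotheses (rho_graded : graded rho) (P_eulerian : eulerian rho).
Hypothesis P_dual_simplicial : dual_simplicial P.
Implicit Types p q v : P.

(** By induction on rank, [sum_gpoly] reads ('X - 1) f + g = 'X^r minus coweights. Up to degree (r -
    1) / 2 the right side vanishes, so g has the differences of f as coefficients; beyond, [gpoly]
    has none. *)
Lemma toric_gE v : toric_g rho v = gpoly rho 'X v.
Proof.
have [k] := ubnP (rho v); elim: k v => // k IH v; rewrite ltnS => vk.
rewrite /toric_g; case: ifP => [/eqP->|/negbT v0].
  by rewrite /gpoly (proj1 rho_graded) big_geq // subr0.
have r0 := rank_gt0 rho_graded v0.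
have fE : ('X - 1) * toric_f rho v + gpoly rho 'X v
  = 'X^(rho v) - \sum_(1 <= i < rho v) coweight 'X (rho v) i *~ face_coef rho v i.
  rewrite -sum_gpoly // (bigD1 v) //= subnn expr0 mulr1 addrC; congr (_ + _).
  rewrite toric_fE // mulr_sumr; apply: eq_big => [p|p pv].
    by rewrite lt_neqAle andbC.
  have rpv := graded_lt rho_graded pv.
  rewrite IH; last exact: leq_trans rpv vk.
  by rewrite mulrCA -exprS; congr (_ * _ ^+ _); lia.
apply/polyP => j; rewrite coef_poly ltnS; case: leqP => [jr|rj]; last first.
  rewrite /gpoly coefB coef1 coef_sum big_nat big1 => [|i ir].
    by rewrite subr0; case: j rj.
  by rewrite coefMrz coef_weight_high // mul0rz.
move: (gpoly _ _ v) fE => g /(congr1 (coefp j)); rewrite /= coefD mulrBl mul1r !coefB coefXM coefXn.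
rewrite coef_sum (eq_big_nat _ _ (F2 := fun=> 0)) => [|i /andP[_ ir]]; last first.
  by rewrite coefMrz coef_coweight_low // mul0rz.
rewrite big1_eq.
have -> : (j == rho v) = false by lia.
rewrite subr0 => /eqP; rewrite addrC addr_eq0 opprB => /eqP ->.
by case: (j).
Qed.

Lemma coef_gpoly v k : (gpoly rho 'X v : {poly int})`_k
  = if k == 0%N then 1 else - \sum_(1 <= i < rho v)
     face_coef rho v i * ('C((rho v).-1 - i, k) * 'C(i.-1, k.-1))%N%:Z.
Proof.
rewrite /gpoly coefB coef1 coef_sum.
rewrite (eq_big_nat _ _ (F2 := fun i => (if k == 0%N then 0 else
  ('C((rho v).-1 - i, k) * 'C(i.-1, k.-1))%N%:Z) *~ face_coef rho v i)); last first.
  by move=> i /andP[i0 _]; rewrite coefMrz coef_weight.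
case: eqP => _; first by rewrite big1 ?subr0 // => i _; rewrite mul0rz.
by rewrite sub0r; congr (- _); apply: eq_bigr => i _; rewrite mulrzz mulrC.
Qed.

Lemma rank_le_top p : (rho p <= rho \top%O)%N.
Proof. by apply: rank_le => //; rewrite lex1. Qed.

(** Below [p] the dual is a reversed Boolean interval, so f is a geometric sum and its truncated
    differences reduce to 1. *)
Lemma toric_g_dual (p : P^d) : (p : P) != \bot%O -> toric_g (dual_rank rho) p = 1.
Proof.
have [k] := ubnP (dual_rank rho p); elim: k p => // k IH p; rewrite ltnS => pk p0.
rewrite /toric_g; case: ifP => // /negbT p1.
have drp : (0 < dual_rank rho p)%N := rank_gt0 (graded_dual rho_graded) p1.
suff -> : toric_f (dual_rank rho) p = \sum_(i < dual_rank rho p) 'X^i.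
  apply/polyP => j; rewrite coef_poly coef1 !coef_sumXn.
  case: j => [|j]; first by rewrite drp subr0.
  rewrite coef_sumXn; case: ifP => //= jp.
  have jlt : (j.+1 < dual_rank rho p)%N by lia.
  by rewrite jlt (ltnW jlt) subrr.
have X1 : 'X - 1 != 0 :> {poly int} by rewrite polyXsubC_eq0.
apply: (mulfI X1); rewrite -subrX1.
have := @sum_interval d P rho rho_graded P_dual_simplicial {poly int} p \top%O ('X - 1) 1 p0.
rewrite lex1 subrK => /(_ isT); rewrite -/(dual_rank rho p) => <-.
rewrite (bigD1 (p : P)) /=; last by rewrite lexx lex1.
rewrite subnn expr0 expr1n mulr1 addrAC subrr add0r toric_fE // mulr_sumr.
apply/esym; apply: eq_big => [q|q /andP[/andP[pq _] qp]].
  by rewrite lex1 andbT andbC -[RHS]/((p : P) < q)%O lt_neqAle eq_sym.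
have {}qp : (p < q :> P)%O by rewrite lt_neqAle eq_sym qp.
have q0 : (q : P) != \bot%O by rewrite -lt0x; apply: le_lt_trans qp; rewrite le0x.
have rq := graded_lt rho_graded qp; have qtop := rank_le_top q.
rewrite IH // ?mul1r -?exprS ?expr1n ?mulr1; last first.
  by apply: leq_trans pk; rewrite /dual_rank; lia.
by congr (_ ^+ _); rewrite /dual_rank; lia.
Qed.

(** As g is 1 below the maximum of the dual, the recurrence for f gives [face_form] at ('X, 1) as 1
    + ('X - 1) f. [toric_h] reads f backwards, and [face_coef_sym] restores the index. *)
Lemma toric_h_dual n : rho \top%O = n.+1 ->
  toric_h (dual_rank rho) 0 = 1 /\
  forall i, (0 < i <= n)%N ->
    toric_h (dual_rank rho) i - toric_h (dual_rank rho) i.-1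
    = - face_coef rho \top%O i.
Proof.
move=> rn; have rho0 := proj1 rho_graded.
(* [top] is the maximum of [P^d], that is, the minimum of [P]. *)
rewrite /toric_h; set top := \top%O.
have topE : (top : P) = \bot%O by [].
have dr : dual_rank rho top = n.+1 by rewrite /dual_rank topE rho0 rn.
have top0 : top != \bot%O.
  by apply/negP => /eqP e; move: dr; rewrite e (proj1 (graded_dual rho_graded)).
pose f := toric_f (dual_rank rho) top; rewrite -/f dr /=.
have fE : face_form rho \top%O 'X 1 = 1 + ('X - 1) * f.
  rewrite face_formE // expr1n /f toric_fE // mulr_sumr; congr (_ + _).
  apply: eq_big => [q|q /andP[_ q0]].
    by rewrite lex1 -[RHS]/((top : P) < q)%O topE lt0x.
  rewrite toric_g_dual // expr1n mulr1 mul1r -exprS; congr (_ ^+ _).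
  have := rank_le_top q; have := rank_gt0 rho_graded q0.
  by rewrite dr /dual_rank rn; lia.
have dE i : face_coef rho \top%O i.+1 = f`_i - f`_i.+1.
  by rewrite /face_coef fE coefD coef1 add0r mulrBl mul1r coefB coefXM.
have f_high : f`_n.+1 = 0.
  rewrite /f toric_fE // coef_sum big1 // => q qtop.
  have q0 : (q : P) != \bot%O by rewrite -lt0x -topE; exact: qtop.
  by rewrite toric_g_dual // mul1r nth_default // size_exp_XsubC dr; lia.
split.
  by rewrite subn0; have := dE n; rewrite f_high subr0 -rn face_coef_top.
case=> // i /andP[_ i_n]; rewrite -face_coef_sym ?rn //.
rewrite subSS (_ : n - i = (n - i.+1).+1)%N; last by lia.
by rewrite dE.
Qed.
End Toric.

(** * Summation by parts *)

Theorem theorem6p6 (d : Order.disp_t) (P : finTBPOrderType d) (rho : P -> nat)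
    (n : nat) (rho_graded : graded rho) (P_eulerian : eulerian rho)
    (P_dual_simplicial : dual_simplicial P) (P_rank : rho \top%O = n.+1) :
  let h := toric_h (dual_rank rho) in
  short_toric rho =
    h 0%N *: (t_ n%:Z - (n%:Z - 1) *: t_ (n%:Z - 2))
    + \sum_(1 <= i < n) h i *:
        \sum_(1 <= k < (n./2).+1)
          (('C(n - i, k) * 'C(i - 1, k - 1))%N%:Z
           - ('C(n - i - 1, k) * 'C(i, k - 1))%N%:Z)
          *: t_ (n%:Z - (2 * k)%N%:Z).
Proof.
move=> h.
have [h0 hE] := toric_h_dual rho_graded P_eulerian P_dual_simplicial P_rank.
rewrite -/h in h0 hE.
have top0 : \top%O != \bot%O :> P.
  by apply/negP => /eqP e; move: P_rank; rewrite e (proj1 rho_graded).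
rewrite {1}/short_toric P_rank [n.+1.-1]/= short_truncE.
have -> : toric_trunc n.+1 (toric_f rho \top%O) = gpoly rho 'X \top%O.
  by rewrite -toric_gE // /toric_g (negPf top0) P_rank.
rewrite [LHS]big_ltn // coef_gpoly // eqxx scale1r muln0 subr0 h0 scale1r -addrA.
congr (_ + _).
(* [B k i] and [B k i.+1] are the two binomial products of the statement. *)
pose B k i : int := ('C(n - i, k) * 'C(i.-1, k.-1))%N%:Z.
(* Summation by parts of (h_i - h_(i-1)) B k i over 1 <= i <= n. The boundary term at i = n vanishes
   as C(0, k) = 0; the one at i = 1 is h_0 B k 1, nonzero only if k = 1. *)
have gE k : (0 < k)%N -> (2 * k <= n)%N ->
    (gpoly rho 'X \top%O : {poly int})`_k
    = \sum_(1 <= i < n) h i * (B k i - B k i.+1) - (n%:Z - 1) *+ (k == 1)%N.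
  move=> k0 kn; rewrite coef_gpoly (gtn_eqF k0) P_rank /= -sumrN.
  rewrite (eq_big_nat _ _ (F2 := fun i => h i * B k i - h i.-1 * B k i)); last first.
    by move=> i ir; rewrite -mulNr -hE // mulrBl.
  rewrite sumrB big_nat_recr ?[X in _ - X]big_ltn; try lia.
  rewrite [X in _ - (_ + X)]big_add1 /=.
  under [in RHS]eq_bigr do rewrite mulrBr.
  rewrite sumrB h0 mul1r {2}/B subnn bin_small // mul0n mulr0 addr0.
  have -> : B k 1%N = (n%:Z - 1) *+ (k == 1)%N.
    rewrite /B; case: k k0 kn => // -[_ n2|k _ _]; last by rewrite bin0n muln0.
    by rewrite bin1 bin0 muln1 subzn //; lia.
  by rewrite opprD addrA addrAC.
rewrite (eq_big_nat _ _ (F2 := fun k =>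
    \sum_(1 <= i < n) (h i * (B k i - B k i.+1)) *: t_ (n%:Z - (2 * k)%N%:Z)
    - ((n%:Z - 1) *+ (k == 1)%N) *: t_ (n%:Z - (2 * k)%N%:Z))); last first.
  by move=> k kn; rewrite gE ?scalerBl ?scaler_suml //; lia.
rewrite sumrB [RHS]addrC; congr (_ - _).
  rewrite exchange_big /=; apply: eq_bigr => i _; rewrite scaler_sumr.
  by apply: eq_bigr => k _; rewrite scalerA /B !subn1 subnS ?subn0.
(* For n = 0 the convention t_(-2) = 0 applies, for n = 1 the factor n - 1 is 0, and otherwise only
   k = 1 survives. *)
case: n {P_rank h hE h0 B gE} => [|[|n]].
- by rewrite big_geq // scaler0.
- by rewrite big_geq // subrr scale0r.
- rewrite big_ltn //= mulr1n big_nat big1 ?addr0 // => k kn.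
  by rewrite (_ : k == 1%N = false) ?mulr0n ?scale0r //; lia.
Qed.
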